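(* Let $x:(I,\frac1m)\to\mathbb{H}$ be an arc-length polarised discrete curve, and let $\hat x:(I,\frac1m)\to\mathbb{H}$ be a non-trivial Darboux transform of $x$ with spectral parameter $\mu$, where $\mu\in\mathbb{R}\setminus\{0\}$ and $\mu\ne m_{ij}$ on every edge $(ij)$. Then $\hat x$ is also arc-length polarised if and only if $|\hat x_i-x_i|^2=\frac1\mu$ at some vertex $i\in I$.
   Context: $\mathbb{H}$ denotes the quaternions, identified with Euclidean $\mathbb{R}^4$ with norm $|\cdot|$. $I$ is a discrete interval (a set of consecutive integers; edges are pairs of consecutive integers). A discrete polarised curve $x:(I,\frac1m)\to\mathbb{H}$ is a map $i\mapsto x_i$ together with a strictly positive or strictly negative real function $m$ on the unoriented edges ($m_{ij}=m_{ji}$). It is arc-length polarised if $|x_i-x_j|^2=\frac{1}{m_{ij}}$ on every edge $(ij)$. Two discrete polarised curves $x,\hat x:(I,\frac1m)\to\mathbb{H}$ are a Darboux pair with spectral parameter $\mu$ ($\hat x$ is a Darboux transform of $x$) if on every edge $(ij)$ $$(x_i-x_j)(x_j-\hat x_j)^{-1}(\hat x_j-\hat x_i)(\hat x_i-x_i)^{-1}=\frac{\mu}{m_{ij}},$$ where $x_i\ne\hat x_i$ for all $i\in I$ and $x_i\neq x_j$ on every edge $(ij)$. The Darboux transform $\hat x$ is called trivial if $\hat x$ is the image of $x$ under the reflection of $\mathbb{R}^4$ across an affine hyperplane, and non-trivial otherwise. *)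

(* Defs.v *)
From HB Require Import structures.
From mathcomp Require Import all_boot all_order all_algebra ring lra.
From mathcomp Require Import reals.
Set Implicit Arguments.
Unset Strict Implicit.
Unset Printing Implicit Defensive.
Import Order.TTheory GRing.Theory Num.Theory.
Local Open Scope ring_scope.

Record quat (R : Type) : Type :=
  Quat { qre : R; qi : R; qj : R; qk : R }.

Section QuatCan.
Variable R : Type.
Definition tuple_of_quat (p : quat R) : R * R * R * R :=
  (qre p, qi p, qj p, qk p).
Definition quat_of_tuple (t : R * R * R * R) : quat R :=
  let: (a, b, c, d) := t in Quat a b c d.
Lemma tuple_of_quatK : cancel tuple_of_quat quat_of_tuple.
Proof. by case. Qed.
End QuatCan.

HB.instance Definition _ (R : eqType) :=
  Equality.copy (quat R) (can_type (@tuple_of_quatK R)).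
HB.instance Definition _ (R : choiceType) :=
  Choice.copy (quat R) (can_type (@tuple_of_quatK R)).

Section QuatRing.
Variable R : comNzRingType.
Implicit Types p q : quat R.

Definition qadd p q : quat R :=
  Quat (qre p + qre q) (qi p + qi q) (qj p + qj q) (qk p + qk q).
Definition qopp p : quat R := Quat (- qre p) (- qi p) (- qj p) (- qk p).
Definition qzero : quat R := Quat 0 0 0 0.
Definition qscale (a : R) p : quat R :=
  Quat (a * qre p) (a * qi p) (a * qj p) (a * qk p).
Definition qone : quat R := Quat 1 0 0 0.
(* i^2 = j^2 = k^2 = ijk = -1 *)
Definition qmul p q : quat R :=
  Quat (qre p * qre q - qi p * qi q - qj p * qj q - qk p * qk q)
       (qre p * qi q + qi p * qre q + qj p * qk q - qk p * qj q)
       (qre p * qj q - qi p * qk q + qj p * qre q + qk p * qi q)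
       (qre p * qk q + qi p * qj q - qj p * qi q + qk p * qre q).

Fact qaddA : associative qadd.
Proof. by move=> [? ? ? ?] [? ? ? ?] [? ? ? ?]; congr Quat; rewrite /= addrA. Qed.
Fact qaddC : commutative qadd.
Proof. by move=> [? ? ? ?] [? ? ? ?]; congr Quat; rewrite /= addrC. Qed.
Fact qadd0l : left_id qzero qadd.
Proof. by move=> [? ? ? ?]; congr Quat; rewrite /= add0r. Qed.
Fact qaddNl : left_inverse qzero qopp qadd.
Proof. by move=> [? ? ? ?]; congr Quat; rewrite /= addNr. Qed.
HB.instance Definition _ :=
  GRing.isZmodule.Build (quat R) qaddA qaddC qadd0l qaddNl.

Fact qmulA : associative qmul.
Proof.
by move=> [a b c d] [e f g h] [i j k l]; congr Quat; rewrite /=; ring.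
Qed.
Fact qmul1l : left_id qone qmul.
Proof. by move=> [? ? ? ?]; congr Quat; rewrite /=; ring. Qed.
Fact qmul1 : right_id qone qmul.
Proof. by move=> [? ? ? ?]; congr Quat; rewrite /=; ring. Qed.
Fact qmulDl : left_distributive qmul qadd.
Proof. by move=> [? ? ? ?] [? ? ? ?] [? ? ? ?]; congr Quat; rewrite /=; ring. Qed.
Fact qmulDr : right_distributive qmul qadd.
Proof. by move=> [? ? ? ?] [? ? ? ?] [? ? ? ?]; congr Quat; rewrite /=; ring. Qed.
Fact qone_neq0 : qone != qzero.
Proof. by apply/eqP => -[] /eqP; rewrite oner_eq0. Qed.
HB.instance Definition _ := GRing.Zmodule_isNzRing.Build (quat R)
  qmulA qmul1l qmul1 qmulDl qmulDr qone_neq0.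

Fact qscaleA a b p : qscale a (qscale b p) = qscale (a * b) p.
Proof. by congr Quat; rewrite /= mulrA. Qed.
Fact qscale1 : left_id 1 qscale.
Proof. by move=> [? ? ? ?]; congr Quat; rewrite /= mul1r. Qed.
Fact qscaleDr : right_distributive qscale +%R.
Proof. by move=> a p q; congr Quat; rewrite /= mulrDr. Qed.
Fact qscaleDl p : {morph qscale^~ p : a b / a + b}.
Proof. by move=> a b; congr Quat; rewrite /= mulrDl. Qed.
HB.instance Definition _ := GRing.Zmodule_isLmodule.Build R (quat R)
  qscaleA qscale1 qscaleDr qscaleDl.

Fact qscaleAl (a : R) p q : a *: (p * q) = (a *: p) * q.
Proof. by congr Quat; rewrite /=; ring. Qed.
HB.instance Definition _ := GRing.Lmodule_isLalgebra.Build R (quat R) qscaleAl.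
Fact qscaleAr (a : R) p q : a *: (p * q) = p * (a *: q).
Proof. by congr Quat; rewrite /=; ring. Qed.
HB.instance Definition _ := GRing.Lalgebra_isAlgebra.Build R (quat R) qscaleAr.

Definition qconj p : quat R := Quat (qre p) (- qi p) (- qj p) (- qk p).
Definition qdot p q : R :=
  qre p * qre q + qi p * qi q + qj p * qj q + qk p * qk q.

Lemma qmul_conj p : p * qconj p = (qdot p p)%:A.
Proof. by congr Quat; rewrite /qdot /=; ring. Qed.
Lemma qmul_conjl p : qconj p * p = (qdot p p)%:A.
Proof. by congr Quat; rewrite /qdot /=; ring. Qed.
End QuatRing.

Section QuatUnit.
Variable R : realFieldType.
Implicit Types p q : quat R.

Lemma qdot_eq0 p : (qdot p p == 0) = (p == 0).
Proof.
apply/eqP/eqP => [|->]; last by rewrite /qdot /=; ring.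
case: p => a b c d; rewrite /qdot /= => h.
have [] : [/\ a ^+ 2 = 0, b ^+ 2 = 0, c ^+ 2 = 0 & d ^+ 2 = 0].
  have := sqr_ge0 a; have := sqr_ge0 b; have := sqr_ge0 c; have := sqr_ge0 d.
  by move: h; rewrite -!expr2 => *; split; lra.
by do 4![move/eqP; rewrite sqrf_eq0 => /eqP ->].
Qed.

Definition qunit : pred (quat R) := fun p => p != 0.
Definition qinv p : quat R := (qdot p p)^-1 *: qconj p.

Fact qmulVl : {in qunit, left_inverse 1 qinv *%R}.
Proof.
move=> p; rewrite unfold_in /qunit -qdot_eq0 => p0.
by rewrite /qinv -scalerAl qmul_conjl scalerA mulVf // scale1r.
Qed.
Fact qmulV : {in qunit, right_inverse 1 qinv *%R}.
Proof.
move=> p; rewrite unfold_in /qunit -qdot_eq0 => p0.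
by rewrite /qinv -scalerAr qmul_conj scalerA mulVf // scale1r.
Qed.
Fact qunitP p q : q * p = 1 /\ p * q = 1 -> qunit p.
Proof.
by case=> h _; apply/eqP => p0; move/eqP: h; rewrite p0 mulr0 eq_sym oner_eq0.
Qed.
Fact qinv_out : {in [predC qunit], qinv =1 id}.
Proof.
move=> p; rewrite inE unfold_in /qunit negbK => /eqP ->.
by congr Quat; rewrite /= ?oppr0 mulr0.
Qed.
HB.instance Definition _ := GRing.NzRing_hasMulInverse.Build (quat R)
  qmulVl qmulV qunitP qinv_out.
End QuatUnit.

Definition qnorm (R : rcfType) (p : quat R) : R := Num.sqrt (qdot p p).

(* Reflection across the affine hyperplane {p | qdot n p = c}, for n != 0. *)
Definition hyperplane_reflection (R : realFieldType) (n : quat R) (c : R)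
    (p : quat R) : quat R :=
  p - (2 * (qdot n p - c) / qdot n n) *: n.

Section DiscreteCurves.
Variable R : realType.

(* The sets of consecutive integers, bounded or not, are exactly the sets of
   members of the terms of type [interval int].  A curve is given on all of
   [int], and only its values on [I] matter; likewise for a function on
   edges, which takes the two endpoints as arguments. *)
Implicit Types (I : interval int) (m : int -> int -> R) (x y : int -> quat R).

Definition edge I (i j : int) : bool :=
  [&& i \in I, j \in I & `|i - j| == 1].

Definition polarisation I m : Prop :=
  (forall i j, edge I i j -> m i j = m j i) /\
  ((forall i j, edge I i j -> 0 < m i j) \/
   (forall i j, edge I i j -> m i j < 0)).

Definition arc_length_polarised I m x : Prop :=
  forall i j, edge I i j -> qnorm (x i - x j) ^+ 2 = 1 / m i j.

Definition darboux_pair I m (mu : R) x y : Prop :=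
  [/\ forall i, i \in I -> x i != y i,
      forall i j, edge I i j -> x i != x j &
      forall i j, edge I i j ->
        (x i - x j) * (x j - y j)^-1 * (y j - y i) * (y i - x i)^-1
        = (mu / m i j)%:A].

Definition trivial_transform I x y : Prop :=
  exists (n : quat R) (c : R),
    n != 0 /\ forall i, i \in I -> y i = hyperplane_reflection n c (x i).

End DiscreteCurves.

(* Main.v *)
Require Import Defs.
From mathcomp Require Import all_boot all_order all_algebra.
From mathcomp Require Import zify ring lra.
From mathcomp Require Import boolp reals.
Import Order.TTheory GRing.Theory Num.Theory.
Local Open Scope ring_scope.

(** Fix an edge (ij) and write [a = x i - x j], [d = xhat i - x i] and
    [e = xhat j - x j] for three sides of the quadrilateral, [b = a + d - e]
    for the fourth one, [xhat i - xhat j].  Since [|a|^2 = 1 / m i j], the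
    inverse of [a] is [m i j] times its conjugate, and the cross-ratio condition
    becomes free of divisions: [b = mu e a^* d] ([darboux_edge]).  Taking norms
    there gives [|b|^2 = mu^2 |e|^2 |a|^2 |d|^2], so [xhat] is arc-length
    polarised exactly when [mu^2 |d|^2 |e|^2 = 1] on every edge.  Grouping the
    terms as [a + d = e (1 + mu a^* d)] and taking norms gives a second relation,
<<
      |a|^2 + 2 <a, d> + |d|^2 = |e|^2 (1 + 2 mu <a, d> + mu^2 |a|^2 |d|^2).
>>
    If [mu |d|^2 = 1], the last factor is [mu |a + d|^2], hence [mu |e|^2 = 1]:
    the condition at one vertex spreads to its neighbours
    ([darboux_edge_distance]) and so to all of [I], and then the product
    [mu^2 |d|^2 |e|^2] is 1 on every edge.  Here [mu] different from [m i j]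
    excludes [a + d = 0].

    Conversely, let [xhat] be arc-length polarised and suppose that
    [mu |d|^2 <> 1] at all vertices.  Putting [mu^2 |d|^2 |e|^2 = 1] into the
    second relation makes it factor as
    [(1 - mu |d|^2) (1 + mu |d|^2 + 2 mu <a, d>) = 0].  So the second factor
    vanishes, and this forces [e] to be a real multiple of [d] and [b] to be the
    mirror image of [a] in the hyperplane orthogonal to [d]
    ([darboux_edge_reflection]).  The hyperplane bisecting the segment from
    [x i] to [xhat i] is then the same for all [i], so [xhat] is a reflection
    of [x], against the hypothesis of non-triviality. *)

(** * Quaternion identities *)

Lemma qdotMM (R : comNzRingType) (p q : quat R) :
  qdot (p * q) (p * q) = qdot p p * qdot q q.
Proof. by case: p => ? ? ? ?; case: q => ? ? ? ?; rewrite /qdot /=; ring. Qed.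

Lemma qdotZZ (R : comNzRingType) (k : R) (p : quat R) :
  qdot (k *: p) (k *: p) = k ^+ 2 * qdot p p.
Proof. by case: p => ? ? ? ?; rewrite /qdot /=; ring. Qed.

Lemma qdotZr (R : comNzRingType) (k : R) (p q : quat R) :
  qdot p (k *: q) = k * qdot p q.
Proof. by case: p => ? ? ? ?; case: q => ? ? ? ?; rewrite /qdot /=; ring. Qed.

Lemma qdotBr (R : comNzRingType) (n p q : quat R) :
  qdot n (p - q) = qdot n p - qdot n q.
Proof.
case: n => ? ? ? ?; case: p => ? ? ? ?; case: q => ? ? ? ?.
by rewrite /qdot /=; ring.
Qed.

Lemma qdotC (R : comNzRingType) (p q : quat R) : qdot p q = qdot q p.
Proof. by case: p => ? ? ? ?; case: q => ? ? ? ?; rewrite /qdot /=; ring. Qed.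

Lemma qdotN (R : comNzRingType) (p : quat R) : qdot (- p) (- p) = qdot p p.
Proof. by case: p => ? ? ? ?; rewrite /qdot /=; ring. Qed.

Lemma qdot_conj (R : comNzRingType) (p : quat R) :
  qdot (qconj p) (qconj p) = qdot p p.
Proof. by case: p => ? ? ? ?; rewrite /qdot /=; ring. Qed.

Lemma qdotDD (R : comNzRingType) (p q : quat R) :
  qdot (p + q) (p + q) = qdot p p + 2 * qdot p q + qdot q q.
Proof. by case: p => ? ? ? ?; case: q => ? ? ? ?; rewrite /qdot /=; ring. Qed.

Lemma qdot_one_conjM (R : comNzRingType) (k : R) (p q : quat R) :
  qdot (1 + k *: (qconj p * q)) (1 + k *: (qconj p * q))
  = 1 + k * (2 * qdot p q) + k ^+ 2 * qdot p p * qdot q q.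
Proof. by case: p => ? ? ? ?; case: q => ? ? ? ?; rewrite /qdot /=; ring. Qed.

Lemma qconjM_polar (R : comNzRingType) (p q : quat R) :
  qconj p * q = (2 * qdot p q)%:A - qconj q * p.
Proof.
by case: p => ? ? ? ?; case: q => ? ? ? ?; congr Quat; rewrite /qdot /=; ring.
Qed.

Lemma qdot_ge0 (R : realFieldType) (p : quat R) : 0 <= qdot p p.
Proof. by rewrite /qdot -!expr2 !addr_ge0 // sqr_ge0. Qed.

Lemma qnorm_sqr (R : rcfType) (p : quat R) : qnorm p ^+ 2 = qdot p p.
Proof. by rewrite /qnorm sqr_sqrtr // qdot_ge0. Qed.

(** * Hyperplane reflections *)

(** The linear part of an affine reflection does not depend on the offset [c],
    so offset 0 serves for differences of points. *)
Lemma hyperplane_reflectionB (R : realFieldType) (n : quat R) (c : R)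
    (p q : quat R) :
  hyperplane_reflection n c p - hyperplane_reflection n c q
  = hyperplane_reflection n 0 (p - q).
Proof.
rewrite /hyperplane_reflection qdotBr; move: (qdot n n)^-1 => v.
move: (qdot n p) (qdot n q) => s t.
by case: n p q => ? ? ? ? [? ? ? ?] [? ? ? ?]; congr Quat; rewrite /=; ring.
Qed.

Lemma hyperplane_reflectionZ (R : realFieldType) (k : R) (n p : quat R) :
  k != 0 ->
  hyperplane_reflection (k *: n) 0 p = hyperplane_reflection n 0 p.
Proof.
move=> k0; rewrite /hyperplane_reflection scalerA qdotZZ qdotC qdotZr qdotC.
have [->|] := eqVneq n 0; first by rewrite !scaler0.
by rewrite -qdot_eq0 => n0; congr (_ - _ *: _); field; rewrite n0.
Qed.

Lemma perpendicular_bisector_reflection (R : realFieldType) (p q : quat R) :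
  p != q ->
  hyperplane_reflection (q - p) (qdot (q - p) (p + q) / 2) p = q.
Proof.
rewrite eq_sym -subr_eq0 -qdot_eq0 => n0.
set n := q - p in n0 *.
have -> : q = p + n by rewrite /n addrC subrK.
have -> : qdot n (p + (p + n)) = 2 * qdot n p + qdot n n.
  by case: (p) => ? ? ? ?; case: (n) => ? ? ? ?; rewrite /qdot /=; ring.
rewrite /hyperplane_reflection.
have -> : 2 * (qdot n p - (2 * qdot n p + qdot n n) / 2) / qdot n n = -1.
  by field.
by rewrite scaleN1r opprK.
Qed.

(** * One edge of a Darboux pair *)

(** The Darboux condition on an edge with sides [a = xi - xj], [d = yi - xi] and
    [e = yj - xj], for an arc-length polarised curve: the fourth side [yi - yj]
    is on the left, and the polarisation has been absorbed in [qconj a]. *)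
Definition darboux_edge {R : realFieldType} (mu : R) (a d e : quat R) :=
  a + d - e = mu *: (e * qconj a * d).

Lemma quadrilateral_edge (V : zmodType) (xi xj yi yj : V) :
  yi - yj = xi - xj + (yi - xi) - (yj - xj).
Proof.
by rewrite [_ + (yi - xi)]addrC addrA subrK opprB addrA subrK.
Qed.

(** Arc-length polarisation says that [(xi - xj)^-1 = m *: qconj (xi - xj)];
    the factor [m] then cancels that of the cross-ratio [mu / m]. *)
Lemma darboux_edge_cross_ratio (R : realFieldType) (mu m : R)
    (xi xj yi yj : quat R) :
  xi != xj -> xi != yi -> xj != yj -> qdot (xi - xj) (xi - xj) = 1 / m ->
  (xi - xj) * (xj - yj)^-1 * (yj - yi) * (yi - xi)^-1 = (mu / m)%:A ->
  darboux_edge mu (xi - xj) (yi - xi) (yj - xj).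
Proof.
rewrite -[xi == xj]subr_eq0 -[xi == yi]subr_eq0 -[xj == yj]subr_eq0.
rewrite -[xi - yi]opprB oppr_eq0 -[xj - yj]opprB oppr_eq0.
rewrite -[yj - yi]opprB (quadrilateral_edge _ xi xj yi yj).
move: (xi - xj) (yi - xi) (yj - xj) => a d e a0 d0 e0 aE.
rewrite /darboux_edge; set b := a + d - e.
have -> : a * (- e)^-1 * - b = a * e^-1 * b by rewrite invrN !mulrN mulNr opprK.
have ua : a \is a GRing.unit by [].
have ud : d \is a GRing.unit by [].
have ue : e \is a GRing.unit by [].
move=> /(congr1 ( *%R^~ d)); rewrite mulrVK // mulr_algl => abE.
have -> : b = e * (a^-1 * (a * e^-1 * b)) by rewrite -mulrA mulKr // mulVKr.
rewrite abE -!scalerAr mulrA.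
have -> : a^-1 = m *: qconj a by rewrite /GRing.inv /= /qinv aE div1r invrK.
have m0 : m != 0.
  by apply: contraNneq a0 => m0; rewrite -qdot_eq0 aE m0 invr0 mulr0.
by rewrite -scalerAr -scalerAl scalerA divfK.
Qed.

Lemma darboux_edge_qdotB {R : realFieldType} {mu : R} {a d e : quat R} :
  darboux_edge mu a d e ->
  qdot (a + d - e) (a + d - e) = mu ^+ 2 * qdot e e * qdot a a * qdot d d.
Proof. by move=> ->; rewrite qdotZZ !qdotMM qdot_conj; ring. Qed.

(** Moving [e] to the right makes the relation purely multiplicative, so that
    norms can be taken; [a + d] is the diagonal [yi - xj]. *)
Lemma darboux_edge_factor {R : realFieldType} {mu : R} {a d e : quat R} :
  darboux_edge mu a d e -> a + d = e * (1 + mu *: (qconj a * d)).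
Proof.
by move=> h; rewrite mulrDr mulr1 -scalerAr mulrA -h [RHS]addrC subrK.
Qed.

Lemma darboux_edge_qdot {R : realFieldType} {mu : R} {a d e : quat R} :
  darboux_edge mu a d e ->
  qdot a a + 2 * qdot a d + qdot d d
  = qdot e e * (1 + mu * (2 * qdot a d) + mu ^+ 2 * qdot a a * qdot d d).
Proof.
by move/darboux_edge_factor => h; rewrite -qdotDD h qdotMM qdot_one_conjM.
Qed.

(** The value [1 / mu] of the squared distance between corresponding points
    spreads along an edge, because for it the norm relation reads
    [|a + d|^2 = mu |e|^2 |a + d|^2]. The diagonal [a + d] cannot vanish:
    otherwise [|a|^2 = |d|^2 = 1 / mu]. *)
Lemma darboux_edge_distance {R : realFieldType} {mu : R} {a d e : quat R} :
  darboux_edge mu a d e -> mu * qdot a a != 1 ->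
  mu * qdot d d = 1 -> mu * qdot e e = 1.
Proof.
move=> h ma md; have := darboux_edge_qdot h.
have -> : 1 + mu * (2 * qdot a d) + mu ^+ 2 * qdot a a * qdot d d
    = mu * qdot (a + d) (a + d).
  by rewrite -{1}md qdotDD expr2; ring: md.
rewrite -qdotDD mulrCA => eqN.
have /eqP : qdot (a + d) (a + d) * (1 - mu * qdot e e) = 0.
  by rewrite mulrBr mulr1 [X in X - _]eqN; ring.
rewrite mulf_eq0 subr_eq0 => /orP[|/eqP //].
rewrite qdot_eq0 addr_eq0 => /eqP aE; case/negP: ma.
by rewrite aE qdotN md.
Qed.

(** Off the value [1 / mu], equality of the lengths of [a] and [a + d - e]
    (expressed by the last hypothesis) determines [<a, d>], and with it
    [e = - d / (mu |d|^2)]; the edge is then reflected. *)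
Lemma darboux_edge_reflection {R : realFieldType} {mu : R} {a d e : quat R} :
  darboux_edge mu a d e -> d != 0 -> mu != 0 -> mu * qdot a a != 1 ->
  mu * qdot d d != 1 -> mu ^+ 2 * qdot d d * qdot e e = 1 ->
  a + d - e = hyperplane_reflection d 0 a.
Proof.
move=> h; rewrite -qdot_eq0 => d0 mu0 ma md de.
(* The norm relation factors, and one factor is nonzero by hypothesis. *)
have pE : mu * (2 * qdot a d) = - (1 + mu * qdot d d).
  have h0 := darboux_edge_qdot h.
  have : (1 - mu * qdot d d) * (1 + mu * qdot d d + mu * (2 * qdot a d)) = 0.
    move: (qdot a a) (qdot a d) (qdot d d) (qdot e e) h0 de => A p s t h0 de.
    have : mu ^+ 2 * s * (A + 2 * p + s)
        = (mu ^+ 2 * s * t) * (1 + mu * (2 * p) + mu ^+ 2 * A * s).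
      by rewrite h0; ring.
    by rewrite de mul1r => /eqP; rewrite eq_sym -subr_eq0 => /eqP <-; ring.
  move/eqP; rewrite mulf_eq0 subr_eq0 eq_sym (negPf md) /= addrC addr_eq0.
  by move/eqP.
have ad0 : a + d \is a GRing.unit.
  apply: contraNneq ma => /eqP; rewrite addr_eq0 => /eqP aE; move: pE.
  rewrite aE qdotN.
  have -> : qdot (- d) d = - qdot d d.
    by rewrite qdotC -scaleN1r qdotZr mulN1r.
  by move=> h1; apply/eqP; lra.
(* With this value of [<a, d>], polarisation of [qconj a * d] turns the right
   factor of [darboux_edge_factor] into a multiple of [a + d], which cancels. *)
have key : 1 + mu *: (qconj a * d) = (- mu) *: (qconj d * (a + d)).
  rewrite qconjM_polar scalerBr scalerA pE (mulrDr (qconj d)) qmul_conjl scalerDr scalerA.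
  rewrite addrA -{1}[1 : quat R]scale1r -scalerDl scaleNr addrC.
  by congr (_ + _ *: _); ring.
have ed : (- mu) *: (e * qconj d) = 1.
  apply: (mulIr ad0); rewrite mul1r [RHS](darboux_edge_factor h) key.
  by rewrite -scalerAl -scalerAr mulrA.
have eE : e = - (mu * qdot d d)^-1 *: d.
  have := congr1 ( *%R^~ d) ed.
  rewrite mul1r -scalerAl -mulrA qmul_conjl mulr_algr scalerA => dE.
  rewrite -[X in _ *: X]dE.
  rewrite scalerA -[LHS]scale1r; congr (_ *: _).
  by field; rewrite mu0 d0.
rewrite /hyperplane_reflection subr0 {1}eE -addrA -{1}[d]scale1r -scaleNr -scalerDl.
rewrite -scaleNr; congr (_ + _ *: _).
rewrite qdotC.
have -> : 2 * qdot a d = - (1 + mu * qdot d d) / mu by rewrite -pE [mu * _]mulrC mulfK.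
by field; rewrite mu0 d0.
Qed.

(** * Propagation along a discrete interval *)

Lemma interval_between (I : interval int) (i j k : int) :
  i \in I -> k \in I -> i <= j -> j <= k -> j \in I.
Proof.
case: I => l u; rewrite !itv_boundlr => /andP[li _] /andP[_ ku] ij jk.
by rewrite (le_trans li) ?(le_trans _ ku) // bnd_simp.
Qed.

(** Edges connect a discrete interval: walk from [i] to [j] by unit steps, which
    stay in [I] by convexity. *)
Lemma interval_edge_ind (I : interval int) (P : int -> Prop) :
  (forall i j, edge I i j -> P i -> P j) ->
  forall i j, i \in I -> j \in I -> P i -> P j.
Proof.
move=> stepP i j iI jI Pi.
have up (n : nat) : i + n%:Z <= j -> P (i + n%:Z).
  elim: n => [|n IHn] nj; first by rewrite addr0.
  have nj' : i + n%:Z <= j by lia.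
  apply: (stepP (i + n%:Z)); last exact: IHn.
  apply/and3P; split; last by lia.
  - by apply: (interval_between _ i _ j) => //; lia.
  - by apply: (interval_between _ i _ j) => //; lia.
have down (n : nat) : j <= i - n%:Z -> P (i - n%:Z).
  elim: n => [|n IHn] nj; first by rewrite subr0.
  have nj' : j <= i - n%:Z by lia.
  apply: (stepP (i - n%:Z)); last exact: IHn.
  apply/and3P; split; last by lia.
  - by apply: (interval_between _ j _ i) => //; lia.
  - by apply: (interval_between _ j _ i) => //; lia.
have [ij|ji] := leP i j.
  have jE : j = i + `|j - i|%N%:Z by lia.
  by rewrite jE; apply: up; rewrite -jE.
have jE : j = i - `|i - j|%N%:Z by lia.
by rewrite jE; apply: down; rewrite -jE.
Qed.

Theorem theorem3p13 (R : realType) (I : interval int) (m : int -> int -> R)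
    (x xhat : int -> quat R) (mu : R)
    (m_pol : polarisation I m)
    (x_arc : arc_length_polarised I m x)
    (x_xhat : darboux_pair I m mu x xhat)
    (nontrivial : ~ trivial_transform I x xhat)
    (mu_neq0 : mu != 0)
    (mu_neq_m : forall i j : int, edge I i j -> mu != m i j) :
  arc_length_polarised I m xhat <->
  (exists i : int, i \in I /\ qnorm (xhat i - x i) ^+ 2 = 1 / mu).
Proof.
case: x_xhat => x_neq_xhat x_neq cross_ratio.
have edge_mem i j : edge I i j -> (i \in I) /\ (j \in I) by case/and3P.
have arcE i j : edge I i j -> qdot (x i - x j) (x i - x j) = 1 / m i j.
  by move=> ij; rewrite -x_arc // qnorm_sqr.
have dE i j : edge I i j ->
    darboux_edge mu (x i - x j) (xhat i - x i) (xhat j - x j).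
  move=> ij; have [iI jI] := edge_mem _ _ ij.
  by apply: darboux_edge_cross_ratio (arcE _ _ ij) (cross_ratio _ _ ij);
    [apply: x_neq | apply: x_neq_xhat | apply: x_neq_xhat].
have non_resonant i j : edge I i j -> mu * qdot (x i - x j) (x i - x j) != 1.
  move=> ij; rewrite arcE //; apply: contraNneq (mu_neq_m _ _ ij) => h.
  have m0 : m i j != 0.
    by apply/eqP => m0; move/eqP: h; rewrite m0 invr0 !mulr0 eq_sym oner_eq0.
  have mum : mu / m i j = 1 by rewrite -[_^-1]mul1r.
  by rewrite -[X in X == _](divfK m0) mum mul1r.
have hatB i j := quadrilateral_edge _ (x i) (x j) (xhat i) (xhat j).
have vertexE i : qnorm (xhat i - x i) ^+ 2 = 1 / mu
    <-> mu * qdot (xhat i - x i) (xhat i - x i) = 1.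
  rewrite qnorm_sqr; split=> [->|h]; first by rewrite mulrCA mulfV ?mulr1.
  by rewrite -h mulrAC mulfV ?mul1r.
split=> [xhat_arc|[i0 [i0I /vertexE vi0]] i j ij]; last first.
  have all_v k : k \in I -> mu * qdot (xhat k - x k) (xhat k - x k) = 1.
    move=> kI; pose P h := mu * qdot (xhat h - x h) (xhat h - x h) = 1.
    apply: (@interval_edge_ind I P _ i0 k) => // {i0 i0I vi0 k kI}k l kl.
    exact: darboux_edge_distance (dE _ _ kl) (non_resonant _ _ kl).
  have [iI jI] := edge_mem _ _ ij.
  rewrite qnorm_sqr hatB (darboux_edge_qdotB (dE _ _ ij)) -arcE //.
  set A := qdot _ (x i - x j); set s := qdot _ (xhat i - x i).
  set t := qdot _ (xhat j - x j).
  have -> : mu ^+ 2 * t * A * s = (mu * t) * (mu * s) * A by ring.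
  by rewrite !all_v // !mul1r.
apply: contrapT => no_vertex; apply: nontrivial.
(* On an empty interval every transform is trivial. *)
have [[i0 i0I]|I0] := pselect (exists i, i \in I); last first.
  exists 1, 0; split=> [|i iI]; first exact: oner_neq0.
  by case: I0; exists i.
(* The mirror is the perpendicular bisector at [i0]; it is carried along. *)
exists (xhat i0 - x i0), (qdot (xhat i0 - x i0) (x i0 + xhat i0) / 2).
have d0 i : i \in I -> xhat i - x i != 0.
  by move=> iI; rewrite subr_eq0 eq_sym x_neq_xhat.
split=> [|k kI]; first exact: d0.
set n := xhat i0 - x i0; set c := _ / 2.
pose P h := xhat h = hyperplane_reflection n c (x h).
apply: (@interval_edge_ind I P _ i0 k) => // {k kI}; last first.
  by rewrite /P perpendicular_bisector_reflection ?x_neq_xhat.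
move=> i j ij xhat_i; have [iI jI] := edge_mem _ _ ij.
(* Normals at other vertices are proportional to the one at [i0]. *)
pose l := - (2 * (qdot n (x i) - c) / qdot n n).
have diE : xhat i - x i = l *: n.
  by rewrite xhat_i /hyperplane_reflection addrAC subrr add0r -scaleNr.
have l0 : l != 0.
  by apply: contraNneq (d0 _ iI) => l0; rewrite diE l0 scale0r.
have md : mu * qdot (xhat i - x i) (xhat i - x i) != 1.
  by apply/eqP => h; apply: no_vertex; exists i; split=> //; apply/vertexE.
have de : mu ^+ 2 * qdot (xhat i - x i) (xhat i - x i)
    * qdot (xhat j - x j) (xhat j - x j) = 1.
  have A0 : qdot (x i - x j) (x i - x j) != 0 by rewrite qdot_eq0 subr_eq0 x_neq.
  apply: (mulIf A0); rewrite mul1r {2}arcE // -xhat_arc // qnorm_sqr hatB.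
  by rewrite (darboux_edge_qdotB (dE _ _ ij)); ring.
have := darboux_edge_reflection (dE _ _ ij) (d0 _ iI) mu_neq0
  (non_resonant _ _ ij) md de.
rewrite -hatB diE hyperplane_reflectionZ // -(hyperplane_reflectionB _ n c).
by rewrite -xhat_i => /addrI /oppr_inj.
Qed.
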